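(* Let $m\in(0,2]$, $\lambda\ge0$ and $q\ge1$. Let $f(x)=\sum_{k=0}^{\infty}x^ka_k$, $a_k\in\mathbb{O}$, be a slice regular function on $\mathbb{B}$ with $|f(x)|\le1$ for all $x\in\mathbb{B}$. Then $$\mathcal{B}_f(x):=|a_0|^m+\sum_{k=1}^{\infty}|x^ka_k|+\lambda|f(x)-a_0|^q\le 1\quad\text{for all } x\in\mathbb{B}\text{ with } |x|\le R_{m,\lambda,q},$$ where $R_{m,\lambda,q}$ is the unique root in $(0,1)$ of the equation $$-\frac{m}{2}+\frac{r}{1-r}+\lambda\left(\frac{r}{1-r}\right)^q=0.$$ In particular, $$\sum_{k=0}^{\infty}|x^ka_k|+|f(x)-a_0|^2\le1\quad\text{for } |x|\le 2-\sqrt{3}.$$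
   Context: $\mathbb{O}$ denotes the real algebra of octonions (the 8-dimensional non-commutative, non-associative but alternative normed division algebra over $\mathbb{R}$), with modulus $|x|=\sqrt{x\overline{x}}$ equal to the Euclidean norm on $\mathbb{R}^8$; the modulus is multiplicative, $|xy|=|x||y|$. $\mathbb{B}=\{x\in\mathbb{O}:|x|<1\}$ is the open unit ball. A slice regular function on $\mathbb{B}$ is (equivalently) a function of the form $f(x)=\sum_{k=0}^{\infty}x^ka_k$ with coefficients $a_k\in\mathbb{O}$ placed on the right, the series converging for every $x\in\mathbb{B}$ (the powers $x^k$ are unambiguous since $\mathbb{O}$ is alternative). *)

(* Defs.v *)
From HB Require Import structures.
From mathcomp Require Import all_boot all_order all_algebra.
From mathcomp Require Import all_classical all_reals all_analysis.
Set Implicit Arguments. Unset Strict Implicit. Unset Printing Implicit Defensive.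
Import Order.TTheory GRing.Theory Num.Theory.
Import numFieldNormedType.Exports.
Local Open Scope ring_scope.

(* Octonions over R, built by the Cayley--Dickson construction from the
   quaternions: O = H x H with (p,q)(r,s) = (p r - conj(s) q, s p + q conj(r)). *)
Section Octonions.
Variable R : realType.

Record quat := Quat { q0 : R; q1 : R; q2 : R; q3 : R }.

Definition qadd (x y : quat) :=
  Quat (q0 x + q0 y) (q1 x + q1 y) (q2 x + q2 y) (q3 x + q3 y).
Definition qopp (x : quat) := Quat (- q0 x) (- q1 x) (- q2 x) (- q3 x).
Definition qconj (x : quat) := Quat (q0 x) (- q1 x) (- q2 x) (- q3 x).
Definition qmul (x y : quat) :=
  Quat (q0 x * q0 y - q1 x * q1 y - q2 x * q2 y - q3 x * q3 y)
       (q0 x * q1 y + q1 x * q0 y + q2 x * q3 y - q3 x * q2 y)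
       (q0 x * q2 y - q1 x * q3 y + q2 x * q0 y + q3 x * q1 y)
       (q0 x * q3 y + q1 x * q2 y - q2 x * q1 y + q3 x * q0 y).

Record oct := Oct { ore : quat; oim : quat }.

Definition oadd (x y : oct) := Oct (qadd (ore x) (ore y)) (qadd (oim x) (oim y)).
Definition oopp (x : oct) := Oct (qopp (ore x)) (qopp (oim x)).
Definition osub (x y : oct) := oadd x (oopp y).
Definition omul (x y : oct) :=
  Oct (qadd (qmul (ore x) (ore y)) (qopp (qmul (qconj (oim y)) (oim x))))
      (qadd (qmul (oim y) (ore x)) (qmul (oim x) (qconj (ore y)))).
Definition ozero : oct := Oct (Quat 0 0 0 0) (Quat 0 0 0 0).
Definition oone : oct := Oct (Quat 1 0 0 0) (Quat 0 0 0 0).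

Definition ocomp (x : oct) (i : 'I_8) : R :=
  nth 0 [:: q0 (ore x); q1 (ore x); q2 (ore x); q3 (ore x);
            q0 (oim x); q1 (oim x); q2 (oim x); q3 (oim x)] i.
Definition oct_of (g : 'I_8 -> R) : oct :=
  Oct (Quat (g (inord 0)) (g (inord 1)) (g (inord 2)) (g (inord 3)))
      (Quat (g (inord 4)) (g (inord 5)) (g (inord 6)) (g (inord 7))).

Definition onorm (x : oct) : R := Num.sqrt (\sum_(i < 8) ocomp x i ^+ 2).

(* powers x^k (unambiguous by alternativity); x^0 = 1, x^(k+1) = x x^k *)
Fixpoint opow (x : oct) (k : nat) : oct :=
  match k with O => oone | S k' => omul x (opow x k') end.

Definition opsum (a : nat -> oct) (x : oct) (n : nat) : oct :=
  foldr oadd ozero [seq omul (opow x k) (a k) | k <- iota 0 n].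

Definition oct_cvg (u : nat -> oct) : Prop :=
  forall i : 'I_8, cvgn (fun n => ocomp (u n) i).

Definition oseries (a : nat -> oct) (x : oct) : oct :=
  oct_of (fun i => limn (fun n => ocomp (opsum a x n) i)).

(* f = sum_k x^k a_k is slice regular on the unit ball B:
   the series converges at every x with |x| < 1 *)
Definition slice_regular_on_ball (a : nat -> oct) : Prop :=
  forall x, onorm x < 1 -> oct_cvg (opsum a x).

Definition radius_eq (m lam q r : R) : R :=
  - (m / 2) + r / (1 - r) + lam * (r / (1 - r)) `^ q.

End Octonions.

(* Main.v *)
(** By alternativity O is a left vector space over each slice C_I = R + R I, and
    f restricted to C_I is a power series with coefficients in it. Given k >= 1,
    choose I and a unit octonion u with a_0 = |a_0| u and a_k in C_I u; projecting
    f orthogonally onto the complex line C_I u yields a scalar holomorphic map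
    of the unit disc into its closure, whence |a_k| <= 1 - |a_0|^2. With t = R / (1 - R)
    both the series and |f(x) - a_0| are then at most (1 - |a_0|^2) t, so that
    B_f(x) is at most
    |a_0|^m + (1 - |a_0|^2) (t + lambda t^q) = |a_0|^m + (1 - |a_0|^2) m / 2,
    which is at most 1 by Young's inequality. *)
Require Import Defs.
From HB Require Import structures.
From mathcomp Require Import all_boot all_order all_algebra.
From mathcomp Require Import all_classical all_reals all_analysis.
From mathcomp Require Import ring lra.
Import Order.TTheory GRing.Theory Num.Theory.
Import numFieldNormedType.Exports.
Local Open Scope ring_scope.
Set Implicit Arguments. Unset Strict Implicit. Unset Printing Implicit Defensive.

(** * Coefficients of bounded trigonometric polynomials *)

Section RealAnalysis.
Variable R : realType.

(** Multiplied by 2 sin h, with h = m pi / N half the angular step, the sum telescopes, and its two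
    end values differ by m full periods. The condition 0 < m < N puts h in (0, pi), so sin h is
    nonzero. *)
Lemma sum_cos_eq0 N m (phi : R) : (0 < m < N)%N ->
  \sum_(j < N) cos (m%:R * (j%:R * (2 * pi / N%:R)) + phi) = 0.
Proof.
case/andP=> m0 mN; have N0 : (0 : R) < N%:R by rewrite ltr0n (ltn_trans m0).
have Nn0 : (N%:R : R) != 0 by rewrite gt_eqF.
set h : R := m%:R * pi / N%:R.
have sh : sin h != 0.
  rewrite gt_eqF // sin_gt0_pi // divr_gt0 ?mulr_gt0 ?pi_gt0 ?ltr0n ?(ltn_trans m0 mN) //=.
  by rewrite /h ltr_pdivrMr // mulrC ltr_pM2l ?pi_gt0 // ltr_nat.
have sh2 : 2 * sin h != 0 by rewrite mulf_neq0 // pnatr_eq0.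
apply: (mulfI sh2); rewrite mulr0 mulr_sumr.
pose g (j : nat) : R := sin ((2 * j%:R - 1) * h + phi).
rewrite -(big_mkord xpredT
  (fun j => 2 * sin h * cos (m%:R * (j%:R * (2 * pi / N%:R)) + phi))).
rewrite (@telescope_sumr_eq _ _ _ g) // /g => [|j _].
  rewrite mulr0 (_ : (2 * N%:R - 1) * h + phi = (0 - 1) * h + phi + (pi *+ 2) *+ m).
    by rewrite (periodicn (@sinD2pi R)) subrr.
  by rewrite /h -[_ *+ m]mulr_natr; field.
rewrite (_ : m%:R * _ + phi = 2 * j%:R * h + phi); last by rewrite /h; field.
rewrite (_ : (2 * j.+1%:R - 1) * h + phi = 2 * j%:R * h + phi + h); last by rewrite -natr1; ring.
rewrite (_ : (2 * j%:R - 1) * h + phi = 2 * j%:R * h + phi - h); last by ring.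
rewrite sinD sinB; ring.
Qed.

Lemma polar_coordinates (p q : R) : exists t : R,
  p = Num.sqrt (p ^+ 2 + q ^+ 2) * cos t /\ q = Num.sqrt (p ^+ 2 + q ^+ 2) * sin t.
Proof.
set rho := Num.sqrt _.
have rho2 : rho ^+ 2 = p ^+ 2 + q ^+ 2 by rewrite sqr_sqrtr // addr_ge0 ?sqr_ge0.
have rho0 : 0 <= rho by exact: sqrtr_ge0.
have [r0|rn0] := eqVneq rho 0.
  move/eqP: rho2; rewrite r0 expr0n eq_sym paddr_eq0 ?sqr_ge0 // !sqrf_eq0.
  by case/andP => /eqP-> /eqP->; exists 0; rewrite !mul0r.
have c1 : (p / rho) ^+ 2 + (q / rho) ^+ 2 = 1.
  by rewrite !expr_div_n -mulrDl -rho2 divff // sqrf_eq0.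
have c11 : -1 <= p / rho <= 1.
  by rewrite -ler_norml -(@ler_sqr _ `|_|) ?nnegrE // real_normK ?num_real //
    expr1n -c1 lerDl sqr_ge0.
have sE : sin (acos (p / rho)) = `|q / rho|.
  by rewrite sin_acos // -sqrtr_sqr; congr (Num.sqrt _); rewrite -c1; ring.
have cE : cos (acos (p / rho)) = p / rho by rewrite acosK // in_itv.
(* [acos] only gives angles in [0, pi], so the sign of the second coordinate decides between this
   angle and its opposite. *)
have [q0|q0] := leP 0 (q / rho).
  exists (acos (p / rho)); rewrite cE sE ger0_norm //; split; field; exact: rn0.
exists (- acos (p / rho)); rewrite cosN sinN cE sE ltr0_norm //; split; field; exact: rn0.
Qed.

(* Average the scalar product of [(F, G)] with [((1 + s^2) cos tau + 2 s, (1 - s^2) sin tau)],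
   [tau = k t + psi], whose length is [1 + s^2 + 2 s cos tau], over [t = 2 pi j / N]. *)
Lemma trig_poly_coef_bound (p q : nat -> R) (K k : nat) (M s : R) :
  (0 < k < K)%N -> 0 <= M -> q 0%N = 0 ->
  (forall t : R,
    (\sum_(n < K) (cos (n%:R * t) * p n - sin (n%:R * t) * q n)) ^+ 2 +
    (\sum_(n < K) (cos (n%:R * t) * q n + sin (n%:R * t) * p n)) ^+ 2 <= M ^+ 2) ->
  2 * s * p 0%N + Num.sqrt (p k ^+ 2 + q k ^+ 2) <= M * (1 + s ^+ 2).
Proof.
case/andP=> k0 kK M0 q00 bnd.
have [psi [pk qk]] := polar_coordinates (p k) (q k); set rho := Num.sqrt _ in pk qk *.
(* With N = K + k nodes there is no aliasing: for n < K, the frequency n + k lies strictly between 0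
   and N, and n - k strictly between -N and N. *)
pose N := (K + k)%N.
have N0 : (0 : R) < N%:R by rewrite ltr0n addn_gt0 k0 orbT.
pose th (j : nat) : R := j%:R * (2 * pi / N%:R).
pose tau j := k%:R * th j + psi.
(* As a complex number, (A, B) is e^(i tau) (1 + s e^(-i tau))^2, whose modulus |1 + s e^(-i tau)|^2
   is a trigonometric polynomial with mean 1 + s^2. *)
pose A j := (1 + s ^+ 2) * cos (tau j) + 2 * s.
pose B j := (1 - s ^+ 2) * sin (tau j).
have sc m phi : (0 < m < N)%N -> \sum_(j < N) cos (m%:R * th j + phi) = 0.
  exact: sum_cos_eq0.
have ss m phi : (0 < m < N)%N -> \sum_(j < N) sin (m%:R * th j + phi) = 0.
  move=> m0N; rewrite -[RHS](sc _ (phi - pi / 2) m0N); apply: eq_bigr => j _.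
  by rewrite addrA -cosBpihalf.
pose F t := \sum_(n < K) (cos (n%:R * t) * p n - sin (n%:R * t) * q n).
pose G t := \sum_(n < K) (cos (n%:R * t) * q n + sin (n%:R * t) * p n).
have le_j j : F (th j) * A j + G (th j) * B j <= M * (1 + s ^+ 2) + M * (2 * s) * cos (tau j).
  have AB : A j ^+ 2 + B j ^+ 2 = (1 + s ^+ 2 + 2 * s * cos (tau j)) ^+ 2.
    rewrite /A /B; have := cos2Dsin2 (tau j).
    move: (cos _) (sin _) => c d cd.
    have d2 : d ^+ 2 = 1 - c ^+ 2 by apply/eqP; rewrite eq_sym subr_eq addrC cd.
    by rewrite [in LHS]exprMn d2; ring.
  have w0 : 0 <= 1 + s ^+ 2 + 2 * s * cos (tau j).
    have := cos2Dsin2 (tau j).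
    move: (cos _) (sin _) => c d cd.
    have := sqr_ge0 (s + c); have := sqr_ge0 d; nra.
  rewrite (_ : _ + M * (2 * s) * _ = M * (1 + s ^+ 2 + 2 * s * cos (tau j))); last by ring.
  have := bnd (th j); rewrite -/(F _) -/(G _) => FG.
  set W := 1 + _ + _ in AB w0 *.
  rewrite real_leNgt ?num_real //; apply/negP => lt.
  have MW0 : 0 <= M * W by rewrite mulr_ge0.
  have : (M * W) ^+ 2 < (F (th j) * A j + G (th j) * B j) ^+ 2.
    by rewrite ltr_sqr ?nnegrE // ltW // (le_lt_trans MW0).
  rewrite exprMn -AB => lt2.
  have : (F (th j) ^+ 2 + G (th j) ^+ 2) * (A j ^+ 2 + B j ^+ 2) <= M ^+ 2 * (A j ^+ 2 + B j ^+ 2).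
    by rewrite ler_wpM2r // addr_ge0 ?sqr_ge0.
  (* Lagrange's identity: this square is the defect in the Cauchy-Schwarz inequality for (F, G) and
     (A, B). *)
  have := sqr_ge0 (F (th j) * B j - G (th j) * A j).
  move: (F (th j)) (G (th j)) lt2 => f g lt2; move: (A j) (B j) lt2 => x y; lra.
have kN : (0 < k < N)%N by rewrite k0 /N -[X in (X < _)%N]add0n ltn_add2r (leq_ltn_trans _ kK).
have : \sum_(j < N) (F (th j) * A j + G (th j) * B j) <=
    \sum_(j < N) (M * (1 + s ^+ 2) + M * (2 * s) * cos (tau j)).
  by apply: ler_sum => j _; exact: le_j.
have stau : \sum_(j < N) cos (tau j) = 0 := sc k psi kN.
rewrite [leRHS]big_split /= -[X in _ <= _ + X]mulr_sumr stau mulr0 addr0.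
have sumN (c : R) : \sum_(j < N) c = c * N%:R by rewrite sumr_const card_ord mulr_natr.
rewrite sumN.
suff -> : \sum_(i < N) (F (th i) * A i + G (th i) * B i) = (2 * s * p 0%N + rho) * N%:R.
  by rewrite ler_pM2r.
(* [T n] collects the contribution of the frequency n. Only n = 0, met by the constant 2 s, and n =
   k, met by e^(i tau), survive the averaging. *)
pose T n := \sum_(j < N) (p n * (cos (n%:R * th j) * A j + sin (n%:R * th j) * B j)
  + q n * (cos (n%:R * th j) * B j - sin (n%:R * th j) * A j)).
have -> : \sum_(i < N) (F (th i) * A i + G (th i) * B i) = \sum_(n < K) T n.
  rewrite /T exchange_big /=; apply: eq_bigr => j _.
  rewrite /F /G !mulr_suml -big_split /=; apply: eq_bigr => n _; ring.
have TE n : T n = p n * (\sum_(j < N) cos (tau j - n%:R * th j)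
      + s ^+ 2 * \sum_(j < N) cos (n%:R * th j + tau j) + 2 * s * \sum_(j < N) cos (n%:R * th j))
   + q n * (\sum_(j < N) sin (tau j - n%:R * th j)
      - s ^+ 2 * \sum_(j < N) sin (n%:R * th j + tau j) - 2 * s * \sum_(j < N) sin (n%:R * th j)).
  rewrite !mulr_sumr -!sumrN -!big_split /= !mulr_sumr -big_split /=; apply: eq_bigr => j _.
  rewrite /A /B; move: (tau j) (n%:R * th j) => y z.
  by rewrite cosB sinB cosD sinD; ring.
have sc0 n : (0 < n < N)%N -> \sum_(j < N) cos (n%:R * th j) = 0.
  by move=> nN; rewrite -[RHS](sc n 0 nN); apply: eq_bigr => j _; rewrite addr0.
have ss0 n : (0 < n < N)%N -> \sum_(j < N) sin (n%:R * th j) = 0.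
  by move=> nN; rewrite -[RHS](ss n 0 nN); apply: eq_bigr => j _; rewrite addr0.
have nkN n : (n < K)%N -> (0 < n + k < N)%N.
  by move=> nK; rewrite addn_gt0 k0 orbT /= /N ltn_add2r.
have scp n : (n < K)%N -> \sum_(j < N) cos (n%:R * th j + tau j) = 0.
  move=> nK; rewrite -[RHS](sc (n + k)%N psi (nkN n nK)); apply: eq_bigr => j _.
  by rewrite /tau addrA -mulrDl -natrD.
have ssp n : (n < K)%N -> \sum_(j < N) sin (n%:R * th j + tau j) = 0.
  move=> nK; rewrite -[RHS](ss (n + k)%N psi (nkN n nK)); apply: eq_bigr => j _.
  by rewrite /tau addrA -mulrDl -natrD.
have K0 : (0 < K)%N by rewrite (ltn_trans k0).
have T0 : T 0%N = 2 * s * p 0%N * N%:R.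
  rewrite TE q00 mul0r addr0 scp //.
  rewrite (eq_bigr (fun j : 'I_N => cos (tau j))) => [|j _]; last by rewrite mul0r subr0.
  rewrite [X in 2 * s * X](eq_bigr (fun=> 1)) => [|j _]; last by rewrite mul0r cos0.
  by rewrite stau sumN; ring.
have Tk : T k = rho * N%:R.
  rewrite TE scp // ssp // sc0 // ss0 //.
  rewrite (eq_bigr (fun=> cos psi)) => [|j _]; last by rewrite /tau addrAC subrr add0r.
  rewrite [X in _ + _ * (X - _ - _)](eq_bigr (fun=> sin psi)) => [|j _]; last first.
    by rewrite /tau addrAC subrr add0r.
  rewrite !sumN !mulr0 !addr0 !subr0 pk qk.
  by rewrite -[rho in RHS]mulr1 -(cos2Dsin2 psi); ring.
have Tn (n : nat) : (n < K)%N -> n != 0%N -> n != k -> T n = 0.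
  move=> nK n0 nk; have nN : (0 < n < N)%N by rewrite lt0n n0 /N ltn_addr.
  rewrite TE scp // ssp // sc0 // ss0 //.
  have [-> ->] : \sum_(j < N) cos (tau j - n%:R * th j) = 0 /\
      \sum_(j < N) sin (tau j - n%:R * th j) = 0.
    have [lt_nk|lt_kn|eq_nk] := ltngtP n k; last by rewrite eq_nk eqxx in nk.
      have b : (0 < k - n < N)%N by rewrite subn_gt0 lt_nk
        (leq_ltn_trans (leq_subr _ _)) //; case/andP: kN.
      rewrite -[X in _ = X /\ _](sc _ psi b) -[X in _ /\ _ = X](ss _ psi b).
      by split; apply: eq_bigr => j _; congr (_ _); rewrite /tau natrB 1?ltnW //; ring.
    have b : (0 < n - k < N)%N by rewrite subn_gt0 lt_kn
      (leq_ltn_trans (leq_subr _ _)) //; case/andP: nN.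
    rewrite -[X in _ = X /\ _](sc _ (- psi) b) -[X in _ /\ _ = X]oppr0.
    rewrite -[X in _ /\ _ = - X](ss _ (- psi) b) -[X in _ /\ _ = X]sumrN.
    split; apply: eq_bigr => j _.
      by rewrite -cosN; congr (cos _); rewrite /tau natrB 1?ltnW //; ring.
    by rewrite -sinN; congr (sin _); rewrite /tau natrB 1?ltnW //; ring.
  by ring.
rewrite (bigD1 (Ordinal K0)) //= (bigD1 (Ordinal kK)) /=; last by rewrite -val_eqE /= -lt0n.
rewrite T0 Tk big1 => [|i /andP[i0 ik]]; last exact: Tn.
ring.
Qed.

End RealAnalysis.

(** * Octonions and complex lines *)

Section OctonionAlgebra.
Variable R : realType.
Implicit Types (x y z u : oct R) (c d t : R).

Definition oscale c x : oct R :=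
  Oct (Quat (c * q0 (ore x)) (c * q1 (ore x)) (c * q2 (ore x)) (c * q3 (ore x)))
      (Quat (c * q0 (oim x)) (c * q1 (oim x)) (c * q2 (oim x)) (c * q3 (oim x))).

Definition oconj x : oct R := Oct (qconj (ore x)) (qopp (oim x)).

Definition odot x y : R :=
  q0 (ore x) * q0 (ore y) + q1 (ore x) * q1 (ore y) +
  q2 (ore x) * q2 (ore y) + q3 (ore x) * q3 (ore y) +
  q0 (oim x) * q0 (oim y) + q1 (oim x) * q1 (oim y) +
  q2 (oim x) * q2 (oim y) + q3 (oim x) * q3 (oim y).

Ltac oct_ring :=
  repeat (intros [[? ? ? ?] [? ? ? ?]] || intro);
  (* [simpl] would duplicate the projections of nested products exponentially *)
  cbv beta iota delta [odot osub omul oadd oopp oscale oconj oone ozero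
    qadd qmul qopp qconj q0 q1 q2 q3 ore oim];
  try (congr (Oct (Quat _ _ _ _) (Quat _ _ _ _))); ring.

Lemma odotC x y : odot x y = odot y x.
Proof. move: x y; oct_ring. Qed.

Lemma odotDl x y z : odot (oadd x y) z = odot x z + odot y z.
Proof. move: x y z; oct_ring. Qed.

Lemma odotDr x y z : odot z (oadd x y) = odot z x + odot z y.
Proof. move: x y z; oct_ring. Qed.

Lemma odotZl c x y : odot (oscale c x) y = c * odot x y.
Proof. move: x y; oct_ring. Qed.

Lemma odotZr c x y : odot y (oscale c x) = c * odot y x.
Proof. move: x y; oct_ring. Qed.

Lemma odot_ge0 x : 0 <= odot x x.
Proof. by rewrite /odot -!expr2 !addr_ge0 ?sqr_ge0. Qed.

Lemma odot_eq0 x : odot x x = 0 -> x = ozero R.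
Proof.
case: x => [[x0 x1 x2 x3] [x4 x5 x6 x7]]; rewrite /odot /= -!expr2 => /eqP.
rewrite !paddr_eq0 ?addr_ge0 ?sqr_ge0 // !sqrf_eq0.
by move=> /andP[/andP[/andP[/andP[/andP[/andP[/andP[]]]]]]] /eqP-> /eqP-> /eqP-> /eqP-> /eqP-> /eqP-> /eqP-> /eqP->.
Qed.

(** This is Degen's eight-square identity. *)
Lemma odot_mul x y : odot (omul x y) (omul x y) = odot x x * odot y y.
Proof. move: x y; oct_ring. Qed.

Lemma odot_mulr x y z : odot (omul x y) z = odot x (omul z (oconj y)).
Proof. move: x y z; oct_ring. Qed.

Lemma omulDl x y z : omul (oadd x y) z = oadd (omul x z) (omul y z).
Proof. move: x y z; oct_ring. Qed.

Lemma omulZl c x y : omul (oscale c x) y = oscale c (omul x y).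
Proof. move: x y; oct_ring. Qed.

Lemma oaddA x y z : oadd x (oadd y z) = oadd (oadd x y) z.
Proof. move: x y z; oct_ring. Qed.

Lemma oadd0x x : oadd (ozero R) x = x.
Proof. move: x; oct_ring. Qed.

Lemma omul1x x : omul (oone R) x = x.
Proof. move: x; oct_ring. Qed.

Lemma osub_addl x y z : osub (oadd x y) z = oadd (osub x z) y.
Proof. move: x y z; oct_ring. Qed.

(** Makes u, I u orthonormal for unit I and u. The next two identities then yield the coordinates of
    exp(t I) x along this pair. *)
Lemma odot_imag_mul x u : q0 (ore x) = 0 -> odot (omul x u) u = 0.
Proof. by move: x u => [[? ? ? ?] [? ? ? ?]] [[? ? ? ?] [? ? ? ?]] /= ->; oct_ring. Qed.

Lemma odot_imag_mul2 x y u : q0 (ore x) = 0 ->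
  odot (omul x y) (omul x u) = odot x x * odot y u.
Proof.
move: x y u => [[? ? ? ?] [? ? ? ?]] [[? ? ? ?] [? ? ? ?]] [[? ? ? ?] [? ? ? ?]] /= ->.
oct_ring.
Qed.

Lemma odot_imag_skew x y u : q0 (ore x) = 0 ->
  odot (omul x y) u = - odot y (omul x u).
Proof.
move: x y u => [[? ? ? ?] [? ? ? ?]] [[? ? ? ?] [? ? ? ?]] [[? ? ? ?] [? ? ? ?]] /= ->.
oct_ring.
Qed.

Lemma oscale_re c x : q0 (ore (oscale c x)) = c * q0 (ore x).
Proof. by []. Qed.

Lemma onormE x : onorm x = Num.sqrt (odot x x).
Proof. by rewrite /onorm !big_ord_recl big_ord0 /ocomp /odot /= -!expr2 addr0 !addrA. Qed.

Lemma onorm_ge0 x : 0 <= onorm x.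
Proof. exact: sqrtr_ge0. Qed.

Lemma sqr_onorm x : onorm x ^+ 2 = odot x x.
Proof. by rewrite onormE sqr_sqrtr ?odot_ge0. Qed.

Lemma onorm_le c x : 0 <= c -> (onorm x <= c) = (odot x x <= c ^+ 2).
Proof. by move=> c0; rewrite -sqr_onorm ler_sqr ?nnegrE ?onorm_ge0. Qed.

Lemma onorm_mul x y : onorm (omul x y) = onorm x * onorm y.
Proof. by rewrite !onormE odot_mul sqrtrM ?odot_ge0. Qed.

Lemma onorm_one : onorm (oone R) = 1.
Proof. by rewrite onormE (_ : odot _ _ = 1) ?sqrtr1 //; oct_ring. Qed.

Lemma onorm_zero : onorm (ozero R) = 0.
Proof. by rewrite onormE (_ : odot _ _ = 0) ?sqrtr0 //; oct_ring. Qed.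

Lemma onorm_scale c x : 0 <= c -> onorm (oscale c x) = c * onorm x.
Proof.
move=> c0; apply/eqP; rewrite -(@eqrXn2 _ 2) ?mulr_ge0 ?onorm_ge0 //.
by rewrite exprMn !sqr_onorm odotZl odotZr mulrA -expr2.
Qed.

Lemma onorm_eq0 x : onorm x = 0 -> x = ozero R.
Proof. by move=> x0; apply: odot_eq0; rewrite -sqr_onorm x0 expr0n. Qed.

Lemma onorm_pow x k : onorm (opow x k) = onorm x ^+ k.
Proof. by elim: k => [|k IH] /=; rewrite ?onorm_one // onorm_mul IH exprS. Qed.

Lemma odot_sqr_le x y : odot x y ^+ 2 <= odot x x * odot y y.
Proof.
have [/odot_eq0 ->|y0] := eqVneq (odot y y) 0.
  rewrite (_ : odot x _ = 0); last by move: x; oct_ring.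
  by rewrite expr0n mulr_ge0 ?odot_ge0.
have yp : 0 < odot y y by rewrite lt0r y0 odot_ge0.
have := odot_ge0 (oadd (oscale (odot y y) x) (oscale (- odot x y) y)).
rewrite !(odotDl, odotDr, odotZl, odotZr) (odotC y x) => h.
rewrite -subr_ge0 -(pmulr_rge0 _ yp); apply: le_trans h _.
by rewrite le_eqVlt; apply/orP; left; apply/eqP; ring.
Qed.

Lemma odot_le_onorm x y : odot x y <= onorm x * onorm y.
Proof.
rewrite real_leNgt ?num_real //; apply/negP => lt_xy.
have xy0 : 0 <= onorm x * onorm y by rewrite mulr_ge0 ?onorm_ge0.
have := odot_sqr_le x y; rewrite leNgt => /negP; apply.
by rewrite -!sqr_onorm -exprMn ltr_sqr // nnegrE ?(ltW (le_lt_trans xy0 lt_xy)).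
Qed.

Lemma onorm_add x y : onorm (oadd x y) <= onorm x + onorm y.
Proof.
rewrite onorm_le ?addr_ge0 ?onorm_ge0 // odotDl !odotDr (odotC y x) sqrrD.
rewrite !sqr_onorm; have := odot_le_onorm x y; lra.
Qed.

Lemma opsumS (a : nat -> oct R) x n :
  opsum a x n.+1 = oadd (opsum a x n) (omul (opow x n) (a n)).
Proof.
rewrite /opsum -addn1 iotaD map_cat foldr_cat /= add0n.
elim: (map _ _) => [|y s IH] /=; last by rewrite IH oaddA.
by move: (omul _ _); oct_ring.
Qed.

Lemma odot_opsum (a : nat -> oct R) x n y :
  odot (opsum a x n) y = \sum_(k < n) odot (omul (opow x k) (a k)) y.
Proof.
elim: n => [|n IH]; last by rewrite opsumS odotDl IH big_ord_recr.
by rewrite big_ord0 /opsum /=; move: y; oct_ring.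
Qed.

Lemma onorm_opsum_diff (a : nat -> oct R) x M n :
  onorm (osub (opsum a x (M + n)) (opsum a x M)) <=
  \sum_(M <= k < M + n) onorm x ^+ k * onorm (a k).
Proof.
elim: n => [|n IH].
  rewrite addn0 big_geq // onorm_le // (_ : osub _ _ = ozero R); last first.
    by move: (opsum _ _ _); oct_ring.
  by rewrite -sqr_onorm onorm_zero.
rewrite addnS opsumS osub_addl big_nat_recr ?leq_addr //=.
by apply: (le_trans (onorm_add _ _)); rewrite lerD // onorm_mul onorm_pow.
Qed.

(* exp(t I) *)
Definition ocis (I : oct R) t : oct R := oadd (oscale (cos t) (oone R)) (oscale (sin t) I).

Section ImaginaryUnit.
Variable I : oct R.
Hypothesis I_re : q0 (ore I) = 0.
Hypothesis I_norm : odot I I = 1.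

(** By alternativity I (I x) = I^2 x, and I^2 = -|I|^2 for imaginary I. Writing 1 as [odot I I]
    turns this into a polynomial identity. *)
Lemma omul_imag x : omul I (omul I x) = oscale (-1) x.
Proof.
rewrite -I_norm; move: I x I_re => [[? ? ? ?] [? ? ? ?]] [[? ? ? ?] [? ? ? ?]] /= ->.
by oct_ring.
Qed.

Lemma omul_ocis c d s t :
  omul (oscale c (ocis I s)) (oscale d (ocis I t)) = oscale (c * d) (ocis I (s + t)).
Proof.
have -> : omul (oscale c (ocis I s)) (oscale d (ocis I t)) =
  oscale (c * d) (oadd (oscale (cos s * cos t) (oone R))
   (oadd (oscale (sin s * sin t) (omul I (omul I (oone R))))
     (oscale (sin s * cos t + cos s * sin t) I))).
  by rewrite /ocis; move: (cos s) (sin s) (cos t) (sin t) => *; move: I; oct_ring.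
rewrite omul_imag /ocis cosD sinD; move: (cos s) (sin s) (cos t) (sin t) => *.
by move: I; oct_ring.
Qed.

(** De Moivre's formula in the slice of I. *)
Lemma opow_ocis c t k : opow (oscale c (ocis I t)) k = oscale (c ^+ k) (ocis I (k%:R * t)).
Proof.
elim: k => [|k IH] /=.
  by rewrite /ocis mul0r cos0 sin0 expr0; move: I; oct_ring.
by rewrite IH omul_ocis -exprS -[in RHS]nat1r mulrDl mul1r.
Qed.

Lemma onorm_ocis c t : 0 <= c -> onorm (oscale c (ocis I t)) = c.
Proof.
move=> c0; rewrite onorm_scale // onormE (_ : odot _ _ = 1) ?sqrtr1 ?mulr1 //.
rewrite -(cos2Dsin2 t) /ocis !(odotDl, odotDr, odotZl, odotZr) I_norm.
rewrite (_ : odot (oone R) I = 0); last first.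
  by rewrite -I_re; move: I; oct_ring.
rewrite (odotC I) (_ : odot (oone R) I = 0); last first.
  by rewrite -I_re; move: I; oct_ring.
rewrite (_ : odot (oone R) _ = 1); last by oct_ring.
ring.
Qed.

Lemma odot_ocis_l c t x u :
  odot (omul (oscale c (ocis I t)) x) u =
  c * (cos t * odot x u - sin t * odot x (omul I u)).
Proof.
rewrite /ocis omulZl omulDl !omulZl omul1x odotZl odotDl !odotZl.
by rewrite odot_imag_skew //; ring.
Qed.

Lemma odot_ocis_r c t x u :
  odot (omul (oscale c (ocis I t)) x) (omul I u) =
  c * (cos t * odot x (omul I u) + sin t * odot x u).
Proof.
rewrite /ocis omulZl omulDl !omulZl omul1x odotZl odotDl !odotZl.
by rewrite odot_imag_mul2 // I_norm; ring.
Qed.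

(** Bessel's inequality: the remainder of x after orthogonal projection onto the span of u and I u
    has nonnegative square length. *)
Lemma odot_bessel u x : odot u u = 1 ->
  odot x u ^+ 2 + odot x (omul I u) ^+ 2 <= odot x x.
Proof.
move=> u1; have Iu := odot_imag_mul u I_re.
have IuIu : odot (omul I u) (omul I u) = 1 by rewrite odot_mul I_norm u1 mulr1.
have := odot_ge0 (oadd x (oadd (oscale (- odot x u) u) (oscale (- odot x (omul I u)) (omul I u)))).
rewrite !(odotDl, odotDr, odotZl, odotZr) (odotC u x) (odotC (omul I u) x) (odotC u) Iu IuIu u1.
nra.
Qed.

End ImaginaryUnit.

(* [I] is the direction of the imaginary part of [b * conj u]. *)
Lemma exists_slice (a b : oct R) : exists I u : oct R,
  [/\ q0 (ore I) = 0, odot I I = 1, odot u u = 1, a = oscale (onorm a) u &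
      odot b u ^+ 2 + odot b (omul I u) ^+ 2 = odot b b].
Proof.
have [u [u1 au]] : exists u : oct R, odot u u = 1 /\ a = oscale (onorm a) u.
  have [a0|a0] := eqVneq (onorm a) 0.
    exists (oone R); split; first by oct_ring.
    by rewrite a0 (onorm_eq0 a0); oct_ring.
  exists (oscale (onorm a)^-1 a); split.
    by rewrite odotZl odotZr -sqr_onorm; field.
  rewrite -[LHS](_ : oscale (onorm a * (onorm a)^-1) a = a); last first.
    by rewrite mulfV //; move: (a); oct_ring.
  by move: (onorm a)^-1 => ?; move: (onorm a) => ?; move: (a); oct_ring.
(* Right multiplication by conj u is an isometry taking u to 1 and, by transposition, the product of
   b with I u to that of b conj u with I. It remains to align I with the imaginary part of b conj
   u. *)
pose be := omul b (oconj u).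
pose im := oadd be (oscale (- q0 (ore be)) (oone R)).
have im0 : q0 (ore im) = 0 by rewrite /im; move: (be); oct_ring.
have bu : odot b u = q0 (ore be) by rewrite /be; move: (b) (u); oct_ring.
have bIu (I : oct R) : odot b (omul I u) = odot be I.
  by rewrite odotC odot_mulr odotC.
have beI (I : oct R) : q0 (ore I) = 0 -> odot be I = odot im I.
  move=> I0; rewrite /im odotDl odotZl (_ : odot (oone R) I = 0) ?mulr0 ?addr0 //.
  by rewrite -I0; move: (I); oct_ring.
have bb : odot b b = q0 (ore be) ^+ 2 + odot im im.
  have -> : odot b b = odot be be.
    have cu : odot (oconj u) (oconj u) = odot u u by move: (u); oct_ring.
    by rewrite /be odot_mul cu u1 mulr1.
  by rewrite /im; move: (be); oct_ring.
have [im1|im1] := eqVneq (onorm im) 0.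
  (* Here b is a real multiple of u, so any imaginary unit serves. *)
  exists (Oct (Quat 0 1 0 0) (Quat 0 0 0 0)), u; split => //; first by oct_ring.
  rewrite bIu bu beI // bb -sqr_onorm im1 (onorm_eq0 im1); oct_ring.
exists (oscale (onorm im)^-1 im), u; split => //.
- by rewrite oscale_re im0 mulr0.
- by rewrite odotZl odotZr -sqr_onorm; field.
- rewrite bIu bu beI; last by rewrite oscale_re im0 mulr0.
  by rewrite odotZr bb -sqr_onorm; field.
Qed.

End OctonionAlgebra.

(** * Coefficients of slice regular functions *)

Section SliceRegular.
Variable R : realType.
Implicit Types (x y z u c : oct R) (a : nat -> oct R) (r : R).

Lemma ocomp_sub x y i : ocomp (osub x y) i = ocomp x i - ocomp y i.
Proof. by case: i => [[|[|[|[|[|[|[|[|?]]]]]]]] ?]. Qed.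

Lemma ocomp_oct_of (g : 'I_8 -> R) i : ocomp (oct_of g) i = g i.
Proof.
by case: i => [[|[|[|[|[|[|[|[|?]]]]]]]] h] //; rewrite /ocomp /=;
  congr g; apply/val_inj; rewrite /= inordK.
Qed.

(** Passes from coordinatewise convergence to norms. It is applied with c = 0 to bound the partial
    sums, and with c a partial sum to estimate the tail. *)
Lemma cvg_onorm_sub (v : nat -> oct R) c : oct_cvg v ->
  (onorm (osub (v n) c) @[n --> \oo] -->
   onorm (osub (oct_of (fun i => limn (fun n => ocomp (v n) i))) c))%classic.
Proof.
move=> cv; set U := oct_of _.
suff h : (\sum_(i < 8) ocomp (osub (v n) c) i ^+ 2 @[n --> \oo] -->
    \sum_(i < 8) ocomp (osub U c) i ^+ 2)%classic.
  exact: (cvg_comp _ _ h (@sqrt_continuous R _)).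
apply: (@cvg_big R^o) => [|i _]; first exact: add_continuous.
rewrite /U ocomp_sub ocomp_oct_of.
under eq_cvg do rewrite ocomp_sub expr2.
by rewrite expr2; apply: cvgM; apply: cvgB; [exact: cv|exact: cvg_cst|exact: cv|exact: cvg_cst].
Qed.

Lemma onorm_sub_le x y : onorm (osub x y) <= onorm x + onorm y.
Proof.
apply: (le_trans (onorm_add _ _)); rewrite lerD2l !onormE /odot /=.
by rewrite !mulrNN.
Qed.

Lemma onorm_le_sub x y : onorm x <= onorm y + onorm (osub y x).
Proof.
rewrite addrC -[leLHS](_ : onorm (osub (osub y x) y) = _); first exact: onorm_sub_le.
rewrite !onormE; congr Num.sqrt; move: x y => [[? ? ? ?] [? ? ? ?]] [[? ? ? ?] [? ? ? ?]].
by rewrite /odot /=; ring.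
Qed.

Section Bounded.
Variable a : nat -> oct R.
Hypothesis areg : slice_regular_on_ball a.
Hypothesis abnd : forall x, onorm x < 1 -> onorm (oseries a x) <= 1.

(** At the real point x = r, the term r^k a_k is the difference of two consecutive partial sums, and
    these are bounded because they converge. *)
Lemma coef_bounded r : 0 <= r < 1 -> exists B, forall k, r ^+ k * onorm (a k) <= B.
Proof.
case/andP=> r0 r1; pose x := oscale r (oone R).
have xr : onorm x = r by rewrite onorm_scale // onorm_one mulr1.
have x1 : onorm x < 1 by rewrite xr.
have cv := cvg_onorm_sub (c := ozero R) (areg x1).
have := cvg_seq_bounded (cvgP _ cv) => -[M [_ /(_ (M + 1))]].
rewrite ltrDl ltr01 => /(_ isT) bM.
exists (M + 1 + (M + 1)) => k.
rewrite -xr -onorm_pow -onorm_mul.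
have bk n : onorm (opsum a x n) <= M + 1.
  have := bM n I; rewrite /= ger0_norm ?onorm_ge0 // => /(le_trans _); apply.
  rewrite (_ : osub _ _ = opsum a x n) //.
  case: (opsum a x n) => [[? ? ? ?] [? ? ? ?]].
  by congr (Oct (Quat _ _ _ _) (Quat _ _ _ _)); rewrite /= oppr0 addr0.
apply: le_trans (lerD (bk k.+1) (bk k)); apply: le_trans (onorm_sub_le _ _).
rewrite opsumS le_eqVlt; apply/orP; left; apply/eqP; congr onorm.
case: (omul _ _) (opsum a x k) => [[? ? ? ?] [? ? ? ?]] [[? ? ? ?] [? ? ? ?]].
by congr (Oct (Quat _ _ _ _) (Quat _ _ _ _)); rewrite /=; ring.
Qed.

(** Used with M large for uniform convergence on a sphere, and with M = 1 for |f(x) - a_0|. *)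
Lemma onorm_oseries_sub_le x M (C : R) : onorm x < 1 ->
  (forall n, \sum_(M <= k < M + n) onorm x ^+ k * onorm (a k) <= C) ->
  onorm (osub (oseries a x) (opsum a x M)) <= C.
Proof.
move=> x1 hC; have cv := cvg_onorm_sub (c := opsum a x M) (areg x1).
rewrite -(cvg_lim (@Rhausdorff R) cv); apply: limr_le; first exact: (cvgP _ cv).
near=> n; have Mn : (M <= n)%N by near: n; exact: nbhs_infty_ge.
by rewrite -(subnKC Mn); apply: le_trans (hC (n - M)%N); exact: onorm_opsum_diff.
Unshelve. all: by end_near. Qed.

Lemma geometric_sum_le (q : R) M n : 0 < q < 1 ->
  \sum_(M <= k < M + n) q ^+ k <= q ^+ M / (1 - q).
Proof.
case/andP=> q0 q1; rewrite geometric_partial_tail.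
by apply: geometric_le_lim; rewrite ?exprn_ge0 ?(ltW q0) // ger0_norm // ltW.
Qed.

(** Transfers the bound on f to its partial sums, uniformly on the sphere |x| = r, so that only
    finite trigonometric sums have to be treated. *)
Lemma opsum_bound r eps : 0 < r < 1 -> 0 < eps ->
  exists K0, forall K x, (K0 <= K)%N -> onorm x = r -> onorm (opsum a x K) <= 1 + eps.
Proof.
(* A radius r' strictly between r and 1 gives terms at most B (r / r')^k on |x| = r, hence a tail
   from K on of at most B q^K / (1 - q) with q = r / r'. *)
case/andP=> r0 r1 eps0; pose r' := (1 + r) / 2.
have r'0 : 0 < r' by rewrite /r'; lra.
have rr' : r < r' by rewrite /r'; lra.
have r'1 : r' < 1 by rewrite /r'; lra.
have [|B hB] := @coef_bounded r'; first by rewrite r'1 ltW.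
pose q := r / r'.
have q0 : 0 < q by rewrite divr_gt0.
have q1 : q < 1 by rewrite ltr_pdivrMr // mul1r.
have B0 : 0 <= B by apply: le_trans (hB 0%N); rewrite mulr_ge0 ?onorm_ge0.
have qc : `|q| < 1 by rewrite gtr0_norm.
have /cvgrPdist_le /(_ eps eps0) [K0 _ hK0] := cvg_geometric (B / (1 - q)) qc.
exists K0 => K x KK xr; apply: (le_trans (onorm_le_sub _ (oseries a x))).
have x1 : onorm x < 1 by rewrite xr.
apply: lerD; first exact: abnd.
apply: onorm_oseries_sub_le => // n.
have := hK0 K KK; rewrite /geometric /= sub0r normrN => h.
apply: le_trans (le_trans (ler_norm _) h).
rewrite mulrAC -mulrA; apply: le_trans (ler_wpM2l B0 (geometric_sum_le K n _)); last by rewrite q0.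
rewrite mulr_sumr; apply: ler_sum => k _.
rewrite xr [X in X ^+ k](_ : r = q * r'); last by rewrite /q divfK // gt_eqF.
by rewrite exprMn -mulrA mulrC ler_wpM2r // exprn_ge0 // ltW.
Qed.

(** Along u and I u, the restriction of f to the circle of radius r in the slice of I has
    coefficients (p n, q n). Those of index 0 are (s, 0), and those of index k carry the full norm
    r^k |a_k|. Taking the free parameter of [trig_poly_coef_bound] equal to s gives 2 s^2 + r^k
    |a_k| <= (1 + eps) (1 + s^2). *)
Lemma scaled_coef_bound r k : 0 < r < 1 -> (0 < k)%N ->
  r ^+ k * onorm (a k) <= 1 - onorm (a 0%N) ^+ 2.
Proof.
move=> r01 k0; set s := onorm (a 0%N); have [r0 r1] := andP r01.
have [I [u [I_re I1 u1 a0u aku]]] := exists_slice (a 0%N) (a k).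
pose p n := r ^+ n * odot (a n) u; pose q n := r ^+ n * odot (a n) (omul I u).
have p0 : p 0%N = s by rewrite /p mul1r a0u odotZl u1 mulr1.
have q0 : q 0%N = 0.
  by rewrite /q a0u odotZl odotC odot_imag_mul // !mulr0.
have pq : Num.sqrt (p k ^+ 2 + q k ^+ 2) = r ^+ k * onorm (a k).
  rewrite /p /q !exprMn -mulrDr aku sqrtrM ?sqr_ge0 // sqrtr_sqr -onormE.
  by rewrite ger0_norm // exprn_ge0 // ltW.
have key eps : 0 < eps -> 2 * s ^+ 2 + r ^+ k * onorm (a k) <= (1 + eps) * (1 + s ^+ 2).
  move=> eps0; have [K0 hK0] := opsum_bound r01 eps0.
  rewrite -pq expr2 mulrA -{2}p0.
  (* The length must reach [K0] for the bound to hold and exceed k for the coefficient to occur. *)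
  apply: (@trig_poly_coef_bound _ _ _ (maxn K0 k.+1)) => //.
  - by rewrite k0 leq_maxr.
  - by rewrite addr_ge0 // ltW.
  move=> t; pose x := oscale r (ocis I t).
  have xr : onorm x = r by rewrite onorm_ocis // ltW.
  have := hK0 _ _ (leq_maxl K0 k.+1) xr; move: (maxn _ _) => K hK.
  rewrite -(_ : odot (opsum a x K) u = \sum_(n < K) _); last first.
    rewrite odot_opsum; apply: eq_bigr => n _.
    by rewrite opow_ocis // odot_ocis_l // /p /q; ring.
  rewrite -(_ : odot (opsum a x K) (omul I u) = \sum_(n < K) _); last first.
    rewrite odot_opsum; apply: eq_bigr => n _.
    by rewrite opow_ocis // odot_ocis_r // /p /q; ring.
  apply: (le_trans (odot_bessel I_re I1 _ u1)).
  by rewrite -onorm_le // addr_ge0 // ltW.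
rewrite real_leNgt ?num_real //; apply/negP => lt.
set W := r ^+ k * _ in key lt.
have s1 : 0 < 1 + s ^+ 2 by rewrite ltr_wpDr ?sqr_ge0.
(* This e makes e (1 + s^2) half of the supposed excess of W over 1 - s^2. *)
pose e := (W - (1 - s ^+ 2)) / 2 / (1 + s ^+ 2).
have e0 : 0 < e by rewrite !divr_gt0 // subr_gt0.
have eE : e * (1 + s ^+ 2) = (W - (1 - s ^+ 2)) / 2 by rewrite /e divfK ?gt_eqF.
have := key _ e0; rewrite [leRHS]mulrDl eE; lra.
Qed.

(** The right-hand side of [scaled_coef_bound] does not depend on r, so r may tend to 1 from the
    left. *)
Lemma coef_bound k : (0 < k)%N -> onorm (a k) <= 1 - onorm (a 0%N) ^+ 2.
Proof.
move=> k0; set A := 1 - _.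
have cv : (r ^+ k * onorm (a k) @[r --> 1^'-] --> 1 ^+ k * onorm (a k))%classic.
  apply: cvg_at_left_filter; apply: cvgM; last exact: cvg_cst.
  exact: exprn_continuous.
rewrite expr1n mul1r in cv.
rewrite -(cvg_lim (@Rhausdorff R) cv); apply: limr_le; first exact: (cvgP _ cv).
near=> r; apply: scaled_coef_bound => //; apply/andP; split; last by near: r; exact: nbhs_left_lt.
by near: r; apply: nbhs_left_gt.
Unshelve. all: by end_near. Qed.

Lemma sum_terms_le r x n : 0 < r < 1 -> onorm x <= r ->
  \sum_(1 <= k < 1 + n) onorm x ^+ k * onorm (a k) <=
  (1 - onorm (a 0%N) ^+ 2) * (r / (1 - r)).
Proof.
(* The coefficient bound at k = 1 shows that 1 - |a_0|^2 is nonnegative. *)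
move=> r01 xr; have A0 := le_trans (onorm_ge0 _) (coef_bound (ltn0Sn 0)).
have := geometric_sum_le 1 n r01; rewrite expr1 => h.
apply: le_trans (ler_wpM2l A0 h); rewrite mulr_sumr big_nat [leRHS]big_nat.
apply: ler_sum => k /andP[k1 _]; rewrite mulrC ler_pM ?exprn_ge0 ?onorm_ge0 ?coef_bound //.
by rewrite lerXn2r ?nnegrE ?onorm_ge0 // (le_trans (onorm_ge0 _) xr).
Qed.

Lemma nneseries_terms_le r x : 0 < r < 1 -> onorm x <= r ->
  (\sum_(1 <= k <oo) (onorm (omul (opow x k) (a k)))%:E <=
   ((1 - onorm (a 0%N) ^+ 2) * (r / (1 - r)))%:E)%E.
Proof.
move=> r01 xr; apply: lime_le.
  by apply: is_cvg_nneseries => n _ _; rewrite lee_fin onorm_ge0.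
near=> n; have n1 : (1 <= n)%N by near: n; exact: nbhs_infty_ge.
rewrite -(subnKC n1) sumEFin lee_fin; apply: le_trans (sum_terms_le _ r01 xr).
by apply: ler_sum => k _; rewrite onorm_mul onorm_pow.
Unshelve. all: by end_near. Qed.

Lemma onorm_sub_coef0_le r x : 0 < r < 1 -> onorm x <= r ->
  onorm (osub (oseries a x) (a 0%N)) <= (1 - onorm (a 0%N) ^+ 2) * (r / (1 - r)).
Proof.
move=> r01 xr; rewrite -{1}(_ : opsum a x 1 = a 0%N); last first.
  rewrite opsumS oadd0x; exact: omul1x.
apply: onorm_oseries_sub_le; first by case/andP: r01 => _; exact: le_lt_trans.
by move=> n; exact: sum_terms_le.
Qed.

End Bounded.
End SliceRegular.

(** * The Bohr-Rogosinski radius *)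

Section Radius.
Variable R : realType.
Implicit Types m lam q r s t : R.

(** Young's inequality for the product of s^m and 1, with exponents 2 / m and 1 / (1 - m / 2), gives
    s^m <= (m / 2) s^2 + 1 - m / 2. At m = 2 the second exponent degenerates, but there equality
    holds. *)
Lemma powR_le_linear m s : 0 < m <= 2 -> 0 <= s ->
  s `^ m + (1 - s ^+ 2) * (m / 2) <= 1.
Proof.
case/andP=> m0; rewrite le_eqVlt => /orP[/eqP->|m2] s0.
  by rewrite (powR_mulrn 2 s0) divff ?mulr1 ?subrKC // addrC subrK.
have p0 : 0 < 2 / m by rewrite divr_gt0.
have q0 : 0 < (1 - m / 2)^-1 by rewrite invr_gt0; lra.
have pq : (2 / m)^-1 + ((1 - m / 2)^-1)^-1 = 1 by rewrite invrK invf_div addrC subrK.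
have := conjugate_powR (powR_ge0 s m) ler01 p0 q0 pq.
rewrite -powRrM powR1 /= !invrK mulr1 invf_div mul1r.
rewrite (_ : m * (2 / m) = 2%:R); last by field; rewrite gt_eqF.
rewrite powR_mulrn //; lra.
Qed.

(** Both r-dependent terms are nondecreasing in t = r / (1 - r), the first strictly, and t increases
    strictly with r. Uniqueness of the root follows. *)
Lemma radius_eq_lt m lam q r1 r2 : 0 <= lam -> 1 <= q ->
  0 < r1 -> r1 < r2 -> r2 < 1 -> radius_eq m lam q r1 < radius_eq m lam q r2.
Proof.
move=> lam0 q1 r10 r12 r21; rewrite /radius_eq -!addrA ltrD2l.
have lt_t : r1 / (1 - r1) < r2 / (1 - r2).
  rewrite ltr_pdivrMr; last lra.
  by rewrite mulrAC ltr_pdivlMr; nra.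
have t0 : 0 <= r1 / (1 - r1) by rewrite divr_ge0; lra.
rewrite ltr_leD // ler_wpM2l // ge0_ler_powR ?nnegrE ?(ltW lt_t) //; first lra.
exact: le_trans t0 (ltW lt_t).
Qed.

(** Setting r / (1 - r) = e^y turns the equation into g(y) = m / 2 with g continuous on the whole
    line, so the intermediate value theorem applies; then r = e^y / (1 + e^y). *)
Lemma radius_eq_root m lam q : 0 < m -> 0 <= lam -> 1 <= q ->
  exists r, 0 < r < 1 /\ radius_eq m lam q r = 0.
Proof.
move=> m0 lam0 q1.
pose g y : R := expR y + lam * expR (q * y).
(* Since t0 <= 1 <= q, t0^q <= t0, so t0 + lam t0^q <= t0 (1 + lam) <= m / 2. At t1 = m / 2 the
   first term alone reaches the target. *)
pose t0 := Num.min 1 (m / 2 / (1 + lam)); pose t1 := m / 2.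
have lam1 : 0 < 1 + lam by lra.
have t00 : 0 < t0 by rewrite lt_min ltr01 !divr_gt0.
have t10 : 0 < t1 by rewrite divr_gt0.
have t0m : t0 * (1 + lam) <= t1 by rewrite -ler_pdivlMr // ge_min lexx orbT.
have t01 : t0 <= t1 by apply: le_trans t0m; rewrite ler_peMr ?(ltW t00) //; lra.
have eln t : 0 < t -> expR (ln t) = t by move=> t_gt0; rewrite lnK.
have gc : continuous g.
  move=> y; apply: cvgD; first exact: continuous_expR.
  apply: cvgM; first exact: cvg_cst.
  apply: continuous_comp; last exact: continuous_expR.
  by apply: cvgM; [exact: cvg_cst|exact: cvg_id].
have gt0 : g (ln t0) <= t1.
  rewrite /g eln //; apply: le_trans t0m; rewrite mulrDr mulr1 lerD2l mulrC ler_wpM2r //.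
  rewrite -[leRHS]eln // ler_expR ler_neMl //.
  by apply: ln_le0; rewrite ge_min lexx.
have gt1 : t1 <= g (ln t1).
  by rewrite /g eln // lerDl mulr_ge0 // expR_ge0.
have [|||y _ gy] := @IVT R g (ln t0) (ln t1) t1.
- by rewrite ler_ln.
- exact: continuous_subspaceT.
- by rewrite ge_min le_max gt0 gt1 orbT.
have e0 := expR_gt0 y; exists (expR y / (1 + expR y)); split.
  by rewrite divr_gt0 ?addr_gt0 //= ltr_pdivrMr ?addr_gt0 // mul1r ltrDr.
rewrite /radius_eq (_ : _ / (1 - _) = expR y); last first.
  by field; rewrite addrK oner_neq0 gt_eqF // addr_gt0.
rewrite /powR gt_eqF // expRK -addrA [X in _ + X]gy; exact: addNr.
Qed.

End Radius.

Lemma bohr_rogosinski (R : realType) (m lam q : R) (a : nat -> oct R) :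
  0 < m <= 2 -> 0 <= lam -> 1 <= q ->
  slice_regular_on_ball a ->
  (forall x : oct R, onorm x < 1 -> onorm (oseries a x) <= 1) ->
  forall Rr : R, 0 < Rr < 1 -> radius_eq m lam q Rr = 0 ->
     forall x : oct R, onorm x <= Rr ->
       (((onorm (a 0%N)) `^ m)%:E
        + (\sum_(1 <= k <oo) (onorm (omul (opow x k) (a k)))%:E)
        + (lam * (onorm (osub (oseries a x) (a 0%N))) `^ q)%:E <= 1%:E)%E.
Proof.
move=> m02 lam0 q1 areg abnd r r01 root x xr.
set s := onorm (a 0%N); pose t := r / (1 - r); pose A := 1 - s ^+ 2.
have s0 : 0 <= s by exact: onorm_ge0.
have A0 : 0 <= A by apply: le_trans (onorm_ge0 _) (coef_bound areg abnd (ltn0Sn 0)).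
have A1 : A <= 1 by rewrite lerBlDr lerDl sqr_ge0.
have t0 : 0 <= t by case/andP: r01 => ? ?; rewrite divr_ge0 ?subr_ge0 // ltW.
have S := nneseries_terms_le areg abnd r01 xr.
have D := onorm_sub_coef0_le areg abnd r01 xr.
have Dq : lam * onorm (osub (oseries a x) (a 0%N)) `^ q <= A * (lam * t `^ q).
  rewrite mulrCA ler_wpM2l //.
  have : onorm (osub (oseries a x) (a 0%N)) `^ q <= (A * t) `^ q.
    apply: ge0_ler_powR; rewrite ?nnegrE ?onorm_ge0 ?(mulr_ge0 A0 t0) //; lra.
  (* As 0 <= A <= 1 <= q, A^q <= A; the case A = 0 is separate because the scaling lemma for powers
     asks for a positive factor. *)
  move/le_trans; apply; have [->|An0] := eqVneq A 0.
    by rewrite !mul0r powR0 //; lra.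
  by apply: ge1r_powRZ => //; rewrite lt0r An0 A0.
apply: le_trans (_ : ((s `^ m)%:E + (A * t)%:E + (A * (lam * t `^ q))%:E <= _)%E).
  by rewrite !leeD // ?lee_fin.
rewrite -!EFinD lee_fin; apply: le_trans (powR_le_linear m02 s0).
(* The root equation says exactly that t + lam t^q = m / 2. *)
rewrite -addrA lerD2l -mulrDr -/A (_ : t + _ = m / 2) //.
by move: root; rewrite /radius_eq -/t; lra.
Qed.

Theorem theorem1p2 (R : realType) (m lam q : R) (a : nat -> oct R) :
  0 < m <= 2 -> 0 <= lam -> 1 <= q ->
  slice_regular_on_ball a ->
  (forall x : oct R, onorm x < 1 -> onorm (oseries a x) <= 1) ->
  (* R_{m,lam,q} is the unique root in (0,1) *)
  (exists! r : R, (0 < r < 1) /\ radius_eq m lam q r = 0) /\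
  (forall Rr : R, 0 < Rr < 1 -> radius_eq m lam q Rr = 0 ->
     forall x : oct R, onorm x <= Rr ->
       (((onorm (a 0%N)) `^ m)%:E
        + (\sum_(1 <= k <oo) (onorm (omul (opow x k) (a k)))%:E)
        + (lam * (onorm (osub (oseries a x) (a 0%N))) `^ q)%:E <= 1%:E)%E) /\
  (forall x : oct R, onorm x <= 2 - Num.sqrt 3 ->
     ((\sum_(0 <= k <oo) (onorm (omul (opow x k) (a k)))%:E)
      + ((onorm (osub (oseries a x) (a 0%N))) ^+ 2)%:E <= 1%:E)%E).

Proof.
move=> m02 lam0 q1 areg abnd; have [m0 _] := andP m02; split; [|split].
- have [r [r01 root]] := radius_eq_root m0 lam0 q1.
  exists r; split=> // r' [r'01 root'].
  have [/andP[r0 r1] /andP[r'0 r'1]] := (r01, r'01).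
  have [lt|lt|//] := ltgtP r r'.
    by have := radius_eq_lt m lam0 q1 r0 lt r'1; rewrite root root' ltxx.
  by have := radius_eq_lt m lam0 q1 r'0 lt r1; rewrite root root' ltxx.
- exact: bohr_rogosinski.
(* This is the case m = 1, lam = 1, q = 2: the equation t + t^2 = 1 / 2 has the positive root t = (w
   - 1) / 2, which corresponds to r = 2 - w. *)
move=> x xr; set w := Num.sqrt 3 in xr.
have w2 : w ^+ 2 = 3 by rewrite sqr_sqrtr.
have w0 : 0 <= w by exact: sqrtr_ge0.
have r01 : 0 < 2 - w < 1 by nra.
have tE : (2 - w) / (1 - (2 - w)) = (w - 1) / 2.
  have : 1 - (2 - w) != 0 by rewrite gt_eqF //; lra.
  move=> d; apply: (mulIf d); rewrite divfK //; nra.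
have root : radius_eq 1 1 2%:R (2 - w) = 0.
  rewrite /radius_eq tE powR_mulrn; last by nra.
  by rewrite mul1r expr_div_n; nra.
have m1 : 0 < (1 : R) <= 2 by rewrite ltr01 ler1n.
have q2 : (1 : R) <= 2%:R by rewrite ler1n.
have := bohr_rogosinski m1 ler01 q2 areg abnd r01 root xr.
rewrite powRr1 ?onorm_ge0 // mul1r powR_mulrn ?onorm_ge0 //.
(* The term of index 0 is |a_0|, which is the first summand of the general inequality for m = 1. *)
rewrite [in X in _ -> X]nneseries_recl //=; last by move=> k _; rewrite lee_fin onorm_ge0.
by rewrite omul1x.
Qed.
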